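(* Let $N$ be an even positive integer such that $N-1$ is an odd prime power, let $x$ be a primitive element of $\mathrm{GF}(N-1)$, and let $q$ be an even (positive) divisor of $N-2$ such that $q\neq N-2$. Let $T$ and $T'$ be subsets of size $q/2$ of $\mathbb{Z}_q$ such that $T'\neq T+a$ for all elements $a$ of $\mathbb{Z}_q$. If $d_1$ and $d_2$ are balanced incomplete block designs obtained by the difference-family construction (described in the context, with the same $q$ and $x$) from $T$ and $T'$, respectively, then $d_1$ and $d_2$ have no blocks in common; therefore their union is also a BIBD with distinct blocks.
   Context: $\mathrm{GF}(s)$ denotes a finite field with $s$ elements; a primitive element is a generator of its cyclic multiplicative group of nonzero elements. For a positive integer $q$, $\mathbb{Z}_q=\{0,1,\ldots,q-1\}$ with addition reduced modulo $q$. For $T\subseteq\mathbb{Z}_q$ and an integer $b$, $T+b=\{t+b: t\in T\}$, with elements reduced modulo $q$ to lie in $\{0,\ldots,q-1\}$. A $\mathrm{BIBD}(v,b,k)$ (balanced incomplete block design) is a family of $b$ blocks, each a $k$-element subset of a set of $v$ treatments, such that every treatment lies in the same number of blocks and every pair of distinct treatments is contained in the same number of blocks; it has distinct blocks if no block is repeated. Difference-family construction. Given $T\subseteq\mathbb{Z}_q$ of size $q/2$, let $e$ be the smallest positive integer such that $T+e=T$, and for $r\in\{0,\ldots,e-1\}$, $a\in\mathrm{GF}(N-1)$ let $S_{r,a}=\{x^{jq+i}+a: 0\le j\le (N-2)/q-1,\ i\in T+r\}$. The designs obtained from $T$, on the treatment set $\mathrm{GF}(N-1)$ and with block size $N/2-1$,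 are: (i) the design with blocks $\{S_{r,a}: r=0,\ldots,e-1,\ a\in\mathrm{GF}(N-1)\}$; and (ii) if $(N-2)/q$ is odd and $U$ is a subset of size $e/2$ of $\{0,\ldots,e-1\}$ such that $U+(q/2)$ (addition reduced modulo $q$) equals the complement of $U$ in $\{0,\ldots,e-1\}$, the design with blocks $\{S_{r,a}: r\in U,\ a\in\mathrm{GF}(N-1)\}$. Each of these is a BIBD with distinct blocks. *)

(* Defs.v *)
From mathcomp Require Import all_boot all_order all_fingroup all_algebra all_solvable.

Set Implicit Arguments.
Unset Strict Implicit.
Unset Printing Implicit Defensive.

Import GRing.Theory.
Local Open Scope ring_scope.

(* A family of blocks is a sequence: repeated blocks are allowed and the order
   carries no meaning. The family has distinct blocks when it is [uniq]. *)
Definition BIBD (V : finType) (v b k : nat) (D : seq {set V}) : Prop :=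
  [/\ #|V| = v,
      size D = b,
      forall B, B \in D -> #|B| = k,
      exists rep : nat, forall s : V,
        count (fun B : {set V} => s \in B) D = rep
    & exists lambda : nat, forall s t : V, s != t ->
        count (fun B : {set V} => (s \in B) && (t \in B)) D = lambda].

(* ['Z_q] is {0, ..., q-1} with addition modulo q provided that q > 1, which
   holds for every even positive q. *)
Definition translate (q : nat) (T : {set 'Z_q}) (b : 'Z_q) : {set 'Z_q} :=
  [set t + b | t in T].

Lemma translate_period_ex (q : nat) (T : {set 'Z_q}) :
  exists e : nat, (0 < e)%N && (translate T e%:R == T).
Proof.
exists (Zp_trunc q).+2; rewrite /=.
have -> : (Zp_trunc q).+2%:R = 0 :> 'Z_q.
  by rewrite Zp_nat; apply/val_inj; rewrite /= modnn.
apply/eqP/setP=> t; apply/imsetP/idP => [[s sT ->]|tT]; first by rewrite addr0.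
by exists t; rewrite ?addr0.
Qed.

Definition period (q : nat) (T : {set 'Z_q}) : nat :=
  ex_minn (translate_period_ex T).

(* {0, ..., e-1} as a subset of Z_q, where e = period T <= q. *)
Definition period_range (q : nat) (T : {set 'Z_q}) : {set 'Z_q} :=
  [set r : 'Z_q | (r < period T)%N].

Definition block (F : finFieldType) (N q : nat) (x : {unit F})
    (T : {set 'Z_q}) (r : 'Z_q) (a : F) : {set F} :=
  [set FinRing.uval x ^+ (j * q + i) + a
    | j : 'I_((N - 2) %/ q), i : 'Z_q in translate T r].

Definition blocks (F : finFieldType) (N q : nat) (x : {unit F})
    (T R : {set 'Z_q}) : seq {set F} :=
  [seq block N x T r a | r <- enum R, a <- enum F].

Definition admissible (q : nat) (T U : {set 'Z_q}) : Prop :=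
  [/\ U \subset period_range T,
      #|U|.*2 = period T
    & translate U (q %/ 2)%:R = period_range T :\: U].

Definition obtained_from (F : finFieldType) (N q : nat) (x : {unit F})
    (T : {set 'Z_q}) (d : seq {set F}) : Prop :=
  perm_eq d (blocks N x T (period_range T)) \/
  (odd ((N - 2) %/ q) /\
   exists2 U : {set 'Z_q}, admissible T U & perm_eq d (blocks N x T U)).

(* Main.v *)
Require Import Defs.
From mathcomp Require Import all_boot all_order all_fingroup all_algebra all_solvable.
From mathcomp Require Import finfield.

Set Implicit Arguments.
Unset Strict Implicit.
Unset Printing Implicit Defensive.

Import GRing.Theory.
Local Open Scope ring_scope.

(** Write [S Y] for the set of the powers [x ^+ k] with [k] mod [q] in [Y] (a
    union of cosets of the subgroup generated by [x ^+ q]); the blocks are the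
    sets [S (T + r) + a].

    A block determines both [a] and [T + r]. As [q] is a proper divisor of
    [N - 2], [x ^+ q] differs from 1, and multiplication by it permutes [S Y],
    so the elements of [S Y] add up to 0 and those of [S Y + a] to [#|S Y| * a].
    Now [#|S Y| = (N - 2) / 2] is nonzero in a field with [N - 1] elements, so
    the sum of a block gives back [a]; subtracting [a] leaves [S Y], which gives
    back [Y] ([block_inj]). Hence a block common to both designs would make
    [T'] a translate of [T], and within one design the blocks are distinct
    since the translates [T + r] with [r] below the period are.

    Two points [s] and [t] lie in as many blocks as there are [r] and [u] with
    [u] and [u - (s - t)] both in [S (T + r)]. Multiplication by [x] takes
    [S Y] to [S (Y + 1)], and the translates [T + r] are permuted when 1 is
    added, so this number does not change when [s - t] is multiplied by [x]:
    it is the same for all pairs of distinct points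
    ([sum_difference_count]). For the half designs, [-1] is a power of [x] whose
    exponent is [q / 2] modulo [q], because [(N - 2) / q] is odd. Exchanging [s]
    and [t] shows that [s - t] and [t - s] give the same count for each [r], so
    [r] and [r + q / 2] contribute equally, and the indices in [U] contribute
    exactly half of the total ([sum_admissible]).
    A union of two BIBDs with the same points and block size is balanced because
    the counts add up. *)

(** * Translates of a subset of Z_q *)

Section Translates.

Variable q : nat.
Implicit Types T Y : {set 'Z_q}.

Lemma mem_translate Y b t : (t \in translate Y b) = (t - b \in Y).
Proof.
apply/imsetP/idP => [[s sY ->]|tY]; first by rewrite addrK.
by exists (t - b) => //; rewrite subrK.
Qed.

Lemma translateD Y a b :
  translate (translate Y a) b = translate Y (a + b).
Proof. by apply/setP=> t; rewrite !mem_translate opprD addrA addrAC. Qed.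

Lemma translate0 Y : translate Y 0 = Y.
Proof. by apply/setP=> t; rewrite mem_translate subr0. Qed.

Lemma translate_inj b : injective (fun Y => translate Y b).
Proof.
by move=> Y Z /(congr1 (fun Y' => translate Y' (- b)));
  rewrite !translateD subrr !translate0.
Qed.

Lemma card_translate Y b : #|translate Y b| = #|Y|.
Proof. exact/card_imset/addIr. Qed.

Lemma period_gt0 T : (0 < period T)%N.
Proof. by rewrite /period; case: ex_minnP => e /andP[]. Qed.

Lemma translate_period T k : translate T (k * period T)%:R = T.
Proof.
have Te : translate T (period T)%:R = T.
  by rewrite /period; case: ex_minnP => e /andP[_ /eqP].
elim: k => [|k IHk]; first exact: translate0.
by rewrite mulSn natrD -translateD Te.
Qed.

Lemma period_min T k : (0 < k)%N -> translate T k%:R = T -> (period T <= k)%N.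
Proof.
move=> k_gt0 Tk; rewrite /period; case: ex_minnP => e _; apply.
by rewrite k_gt0 Tk eqxx.
Qed.

Lemma translate_period_inj T : {in period_range T &, injective (translate T)}.
Proof.
(* Were [r < s] with equal translates, [s - r] would be a shorter period. *)
have small_diff (r s : 'Z_q) : (s < period T)%N ->
    translate T r = translate T s -> (s <= r)%N || (period T <= s)%N.
  move=> s_lt Trs; case: leqP => //= r_lt_s.
  apply: leq_trans (leq_subr r s); apply: period_min; first by rewrite subn_gt0.
  rewrite natrB ?(ltnW r_lt_s) // !natr_Zp -translateD -Trs translateD.
  by rewrite subrr translate0.
move=> r s; rewrite !inE => r_lt s_lt Trs; apply/val_inj/eqP.
have := small_diff _ _ s_lt Trs; have := small_diff _ _ r_lt (esym Trs).
by rewrite ![(period T <= _)%N]leqNgt r_lt s_lt !orbF /= eqn_leq => -> ->.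
Qed.

(** [T + b] only depends on [b] modulo the period, so the offsets below the
    period yield all translates, a family on which translation acts. *)
Lemma translate_orbit T :
  [set translate T r | r in period_range T] = [set translate T b | b : 'Z_q].
Proof.
apply/setP=> Y; apply/imsetP/imsetP=> -[b _ ->]; first by exists b.
have lt_b : (b %% period T < period T)%N := ltn_pmod _ (period_gt0 T).
have le_b : (b %% period T < (Zp_trunc q).+2)%N.
  exact: leq_ltn_trans (leq_mod _ _) (ltn_ord b).
exists (Ordinal le_b); first by rewrite inE.
rewrite -[Ordinal _]natr_Zp -[in LHS](natr_Zp b) /=.
by rewrite [in LHS](divn_eq b (period T)) natrD -translateD translate_period.
Qed.

(** Adding [c] permutes the translates of [T]; on the offsets themselves it
    would be addition modulo the period, which is awkward inside [Z_q]. *)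
Lemma sum_orbit_shift T (h : {set 'Z_q} -> nat) c :
  (\sum_(r in period_range T) h (translate (translate T r) c) =
   \sum_(r in period_range T) h (translate T r))%N.
Proof.
rewrite -!(big_imset _ (@translate_period_inj T)) /=.
rewrite -(big_imset (fun Y => h (translate Y c)) (@translate_period_inj T)) /=.
rewrite translate_orbit [RHS](reindex_inj (@translate_inj c)) /=.
apply: eq_bigl => Y; apply/imsetP/imsetP => -[b _ Yb].
  by exists (b + c) => //; rewrite Yb translateD.
exists (b - c) => //; apply: (@translate_inj c).
by rewrite translateD subrK.
Qed.

End Translates.

(** * Unions of cyclotomic classes *)

Section Cyclotomy.

Variables (F : finFieldType) (N q : nat) (x : {unit F}).
Hypothesis (card_F : #|F| = (N - 1)%N).
Hypothesis (x_primitive : generator [set: {unit F}] x).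
Hypotheses (q_gt1 : (1 < q)%N) (q_dvd : (q %| N - 2)%N).

Local Notation w := (FinRing.uval x).
Local Notation n := ((N - 2) %/ q)%N.

(** The part of a block that is compatible with multiplication: multiplying by
    [w] shifts [Y] by 1, whereas on a block it also changes the offset [a]. *)
Definition cyclotomic (Y : {set 'Z_q}) : {set F} :=
  [set w ^+ (j * q + i) | j : 'I_n, i : 'Z_q in Y].

Lemma N2E : (N - 2 = #|F|.-1)%N.
Proof. by rewrite card_F -subn1 -subnDA. Qed.

Lemma order_primitive : #[x]%g = (N - 2)%N.
Proof. by rewrite orderE -(eqP x_primitive) card_finField_unit N2E. Qed.

Lemma eq_primitive_exp k l : (w ^+ k == w ^+ l) = (k == l %[mod N - 2])%N.
Proof.
rewrite -order_primitive -eq_expg_mod_order.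
by rewrite -!FinRing.val_unitX (inj_eq val_inj).
Qed.

Lemma N2_gt0 : (0 < N - 2)%N.
Proof. by rewrite -order_primitive order_gt0. Qed.

Lemma primitive_neq0 : w != 0.
Proof. by rewrite -unitfE; exact: valP. Qed.

Lemma primitive_expP z : z != 0 -> exists k, z = w ^+ k.
Proof.
rewrite -unitfE => Uz.
have: FinRing.Unit Uz \in <[x]>%g by rewrite -(eqP x_primitive) inE.
by case/cycleP=> k /(congr1 val) /= ->; exists k; rewrite FinRing.val_unitX.
Qed.

Lemma residue_lt (i : 'Z_q) : (i < q)%N.
Proof. by rewrite -{2}(Zp_cast q_gt1). Qed.

Lemma residueE j (i : 'Z_q) : (j * q + i)%:R = i :> 'Z_q.
Proof. by rewrite natrD natrM pchar_Zp // mulr0 add0r natr_Zp. Qed.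

(** The exponent of a power of [w] is defined modulo [N - 2], hence also modulo
    its divisor [q]: membership only depends on the discrete logarithm. *)
Lemma mem_cyclotomic_exp Y k : (w ^+ k \in cyclotomic Y) = (k%:R \in Y).
Proof.
apply/imset2P/idP => [[j i _ iY /eqP]|kY].
  rewrite eq_primitive_exp => /eqP/(congr1 (modn^~ q)).
  rewrite !modn_dvdm // => /(congr1 (fun m => m%:R : 'Z_q)).
  by rewrite !Zp_nat_mod // residueE => ->.
have j_lt : (k %% (N - 2) %/ q < n)%N.
  by rewrite ltn_divLR ?(ltnW q_gt1) // divnK // ltn_pmod // N2_gt0.
exists (Ordinal j_lt) (k%:R) => //=; apply/eqP.
rewrite eq_primitive_exp val_Zp_nat // -(modn_dvdm k q_dvd) -divn_eq.
by rewrite modn_mod.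
Qed.

Lemma cyclotomic0 Y : 0 \notin cyclotomic Y.
Proof.
apply/imset2P => -[j i _ _ /esym/eqP].
by rewrite expf_eq0 (negPf primitive_neq0) andbF.
Qed.

(** Multiplication by a power of [w] adds a constant to discrete logarithms.
    This one fact gives both the vanishing of sums and the balance of pairs. *)
Lemma cyclotomic_scale Y k z :
  (w ^+ k * z \in cyclotomic (translate Y k%:R)) = (z \in cyclotomic Y).
Proof.
have [->|/primitive_expP[l ->]] := eqVneq z 0.
  by rewrite mulr0 !(negPf (cyclotomic0 _)).
by rewrite -exprD !mem_cyclotomic_exp mem_translate natrD addrC addKr.
Qed.

Lemma cyclotomic_inj : injective cyclotomic.
Proof.
move=> Y Z /setP YZ; apply/setP=> i.
by have := YZ (w ^+ i); rewrite !mem_cyclotomic_exp natr_Zp.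
Qed.

Lemma card_cyclotomic Y : #|cyclotomic Y| = (n * #|Y|)%N.
Proof.
pose f (ji : 'I_n * 'Z_q) := w ^+ (ji.1 * q + ji.2).
have -> : cyclotomic Y = f @: setX [set: 'I_n] Y.
  apply/setP=> z; apply/imset2P/imsetP => [[j i _ iY ->]|[[j i]]].
    by exists (j, i); rewrite ?in_setX ?inE.
  by rewrite in_setX inE /= => iY ->; exists j i.
have f_lt (ji : 'I_n * 'Z_q) : (ji.1 * q + ji.2 < N - 2)%N.
  case: ji => j i /=; rewrite -[leqRHS](divnK q_dvd).
  apply: (@leq_trans (j.+1 * q)); last by rewrite leq_mul2r ltn_ord orbT.
  by rewrite mulSn addnC ltn_add2r residue_lt.
rewrite card_imset ?cardsX ?cardsT ?card_ord // => ji ji' /eqP.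
rewrite eq_primitive_exp !modn_small ?f_lt // => /eqP E.
case: ji ji' E => [j i] [j' i'] /= E; congr (_, _); apply: val_inj => /=.
  move/(congr1 (divn^~ q)): E.
  by rewrite !divnMDl ?(ltnW q_gt1) // !(divn_small (residue_lt _)) !addn0.
by move/(congr1 (modn^~ q)): E; rewrite !modnMDl !modn_small ?residue_lt.
Qed.

Lemma mem_block (Y : {set 'Z_q}) r a z :
  (z \in block N x Y r a) = (z - a \in cyclotomic (translate Y r)).
Proof.
apply/imset2P/imset2P => -[j i _ iY E]; exists j i => //.
  by rewrite E addrK.
by rewrite -E subrK.
Qed.

Lemma blockE (Y : {set 'Z_q}) r a :
  block N x Y r a = [set z + a | z in cyclotomic (translate Y r)].
Proof.
apply/setP=> z; rewrite mem_block; apply/idP/imsetP => [zY|[y yY ->]].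
  by exists (z - a); rewrite ?subrK.
by rewrite addrK.
Qed.

Lemma card_block (Y : {set 'Z_q}) r a : #|block N x Y r a| = (n * #|Y|)%N.
Proof.
rewrite blockE card_imset ?card_cyclotomic ?card_translate //.
exact: addIr.
Qed.

(** Multiplication by [w ^+ q] permutes the summands, so the sum is fixed by
    multiplication by an element other than 1. *)
Lemma sum_cyclotomic Y : q <> (N - 2)%N -> \sum_(z in cyclotomic Y) z = 0.
Proof.
move=> q_neq; set s := \sum_(_ in _) _.
have wq_neq0 : w ^+ q != 0 by rewrite expf_neq0 ?primitive_neq0.
have wq_neq1 : w ^+ q - 1 != 0.
  rewrite subr_eq0 -[1](expr0 w) eq_primitive_exp mod0n -/(dvdn _ _).
  apply/negP=> /(dvdn_leq (ltnW q_gt1)) le_q.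
  by apply/q_neq/eqP; rewrite eqn_leq le_q dvdn_leq ?N2_gt0.
have wq_s : w ^+ q * s = s.
  rewrite big_distrr /= [RHS](reindex_inj (mulfI wq_neq0)) /=.
  apply: eq_bigl => z; rewrite -(cyclotomic_scale Y q z).
  by rewrite (pchar_Zp q_gt1) translate0.
by apply: (mulfI wq_neq1); rewrite mulr0 mulrBl mul1r wq_s subrr.
Qed.

(** * A block determines its parameters *)

Hypotheses (q_even : ~~ odd q) (q_neq : q <> (N - 2)%N).

Lemma double_card (Y : {set 'Z_q}) : #|Y| = (q %/ 2)%N ->
  (n * #|Y|).*2 = (N - 2)%N.
Proof.
by move=> ->; rewrite -muln2 -mulnA divnK ?dvdn2 // divnK.
Qed.

(** Otherwise [#|F| = k + k + 1] would be 1 in [F], whereas it is 0 there. *)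
Lemma half_neq0 k : k.*2 = (N - 2)%N -> k%:R != 0 :> F.
Proof.
move=> k2; apply/negP => /eqP k0.
have: #|F|%:R = 0 :> F.
  by rewrite -FinRing.zmodXgE -cardsT expg_cardG ?inE.
rewrite -(prednK (_ : 0 < #|F|)%N); last by apply/card_gt0P; exists 0.
by rewrite -N2E -k2 -addnn -natr1 natrD k0 !add0r => /eqP; rewrite oner_eq0.
Qed.

(** The elements of a block add up to its size times [a], and the size, half of
    [#|F| - 1], is invertible in [F]; so the sum recovers [a]. *)
Lemma block_inj (Y Z : {set 'Z_q}) r s a b :
  #|Y| = (q %/ 2)%N -> block N x Y r a = block N x Z s b ->
  translate Y r = translate Z s /\ a = b.
Proof.
move=> card_Y E.
have sum_block (Y' : {set 'Z_q}) r' a' :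
    \sum_(z in block N x Y' r' a') z = (#|block N x Y' r' a'|)%:R * a'.
  rewrite card_block {1}blockE big_imset /=.
    2: by move=> ? ? _ _; exact: addIr.
  rewrite big_split /= sum_cyclotomic // add0r sumr_const card_cyclotomic.
  by rewrite card_translate mulr_natl.
have ab : a = b.
  have := congr1 (fun B : {set F} => \sum_(z in B) z) E.
  rewrite /= !sum_block -E.
  by apply: mulfI; rewrite half_neq0 // card_block double_card.
split=> //; apply/cyclotomic_inj/setP=> z.
by have /setP/(_ (z + a)) := E; rewrite -{}ab !mem_block (addrK a z).
Qed.

Lemma uniq_blocks (T R : {set 'Z_q}) :
  #|T| = (q %/ 2)%N -> R \subset period_range T -> uniq (blocks N x T R).
Proof.
move=> card_T /subsetP sR; apply: allpairs_uniq; rewrite ?enum_uniq //.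
move=> _ _ /allpairsP[[r a] /= [rR _ ->]] /allpairsP[[s b] /= [sR' _ ->]] /= E.
have [Trs ->] := block_inj card_T E; congr (_, _).
by apply: translate_period_inj Trs; apply: sR; rewrite -mem_enum.
Qed.

(** * Balance of pairs *)

(** For [d = 0] this is the size of [cyclotomic Y], so that the same count
    serves for single points and for pairs of points. *)
Definition difference_count (Y : {set 'Z_q}) (d : F) : nat :=
  #|[set u in cyclotomic Y | u - d \in cyclotomic Y]|.

Lemma difference_count_scale Y k d :
  difference_count (translate Y k%:R) (w ^+ k * d) = difference_count Y d.
Proof.
have wk_neq0 : w ^+ k != 0 by rewrite expf_neq0 ?primitive_neq0.
rewrite /difference_count -[RHS](card_imset _ (mulfI wk_neq0)).
apply/eq_card => z; rewrite inE; apply/idP/imsetP.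
  rewrite -[z in X in X -> _](mulVKf wk_neq0) -mulrBr !cyclotomic_scale => zY.
  by exists ((w ^+ k)^-1 * z); rewrite ?inE // mulVKf.
by case=> y; rewrite inE => yY ->; rewrite -mulrBr !cyclotomic_scale.
Qed.

(** Exchanging the two terms of a difference, that is [u] and [u - d], changes
    its sign. *)
Lemma difference_countN Y d : difference_count Y (- d) = difference_count Y d.
Proof.
rewrite /difference_count -[RHS](card_imset _ (addIr (- d))).
apply/eq_card => z; rewrite inE opprK; apply/idP/imsetP => [/andP[zY zdY]|[y]].
  by exists (z + d); rewrite ?inE ?addrK ?zY ?zdY.
by rewrite inE => /andP[yY ydY] ->; rewrite subrK yY ydY.
Qed.

(** For a fixed [r], the blocks containing [s] and [t] correspond to their
    offsets [a]; the substitution [u = s - a] turns the two conditions into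
    [u] and [u - (s - t)] lying in the same cyclotomic set. *)
Lemma count_blocks (T R : {set 'Z_q}) s t :
  count (fun B : {set F} => (s \in B) && (t \in B)) (blocks N x T R) =
  (\sum_(r in R) difference_count (translate T r) (s - t)%R)%N.
Proof.
rewrite count_flatten sumnE !big_map big_enum /=.
apply: eq_bigr => r _; rewrite count_map -sum1_count big_enum_cond sum1dep_card.
have sub_inj : injective (fun a : F => s - a) by move=> a b /addrI/oppr_inj.
rewrite -(card_imset _ sub_inj); apply: eq_card => u; rewrite !inE.
apply/imsetP/andP => [[a]|[uY uY']].
  rewrite inE /= !mem_block => /andP[sY tY] ->; split=> //.
  by rewrite opprB addrC addrA subrK.
exists (s - u); last by rewrite opprB addrC subrK.
rewrite inE /= !mem_block opprB [s + _]addrC subrK uY /=.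
by move: uY'; rewrite opprB addrCA.
Qed.

(** Write [d] as [w ^+ k]: multiplying 1 by [w ^+ k] while shifting by [k]
    preserves each count, and the shift only permutes the translates of [T]. *)
Lemma sum_difference_count T d : d != 0 ->
  (\sum_(r in period_range T) difference_count (translate T r) d =
   \sum_(r in period_range T) difference_count (translate T r) 1%R)%N.
Proof.
move=> /primitive_expP[k ->].
rewrite -(sum_orbit_shift T (fun Y => difference_count Y (w ^+ k)) k%:R).
by apply: eq_bigr => r _; rewrite -[w ^+ k]mulr1 difference_count_scale.
Qed.

Lemma expr_half : w ^+ (n * (q %/ 2)) = -1.
Proof.
have: (n * (q %/ 2)).*2 = (N - 2)%N.
  by rewrite -muln2 -mulnA divnK ?dvdn2 // divnK.
move: (_ * _)%N => h h2.
have h_gt0 : (0 < h)%N by rewrite -double_gt0 h2 N2_gt0.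
have: (w ^+ h) ^+ 2 == 1.
  by rewrite -exprM muln2 h2 -[1](expr0 w) eq_primitive_exp modnn mod0n.
rewrite sqrf_eq1 => /orP[|/eqP //].
rewrite -[1](expr0 w) eq_primitive_exp mod0n -/(dvdn _ _) -h2.
by move/(dvdn_leq h_gt0); rewrite leqNgt -addnn -addn1 leq_add2l h_gt0.
Qed.

(** Multiplying by -1 shifts by the residue of its exponent
    [((N - 2) / q) * (q / 2)], which is [q / 2] when the first factor is odd,
    and does not change the count of differences. *)
Lemma difference_count_half Y d : odd n ->
  difference_count (translate Y (q %/ 2)%:R) d = difference_count Y d.
Proof.
move=> n_odd; rewrite -[RHS]difference_countN.
rewrite -(difference_count_scale Y (n * (q %/ 2)) (- d)) expr_half mulrNN mul1r.
suff -> : (n * (q %/ 2))%:R = (q %/ 2)%:R :> 'Z_q by [].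
rewrite -[n]odd_double_half n_odd mulnDl mul1n natrD -muln2 -mulnA.
by rewrite [(2 * _)%N]mulnC divnK ?dvdn2 // natrM pchar_Zp // mulr0 addr0.
Qed.

(** The offsets below the period are those of [U] and their shifts by [q / 2],
    which have the same counts. *)
Lemma sum_admissible (T U : {set 'Z_q}) d : odd n -> admissible T U ->
  ((\sum_(r in U) difference_count (translate T r) d).*2 =
   \sum_(r in period_range T) difference_count (translate T r) d)%N.
Proof.
move=> n_odd [sU _ UE]; rewrite [RHS](big_setID U) /= (setIidPr sU) -UE -addnn.
congr addn; rewrite big_imset /=; last by move=> ? ? _ _; exact: addIr.
by apply: eq_bigr => r _; rewrite -translateD difference_count_half.
Qed.

(** Both kinds of designs are indexed by a set [R] of offsets below the period
    over which the difference counts of a nonzero [d] add up to a constant; by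
    [count_blocks], this is the balance of the design. *)
Lemma obtained_fromP (T : {set 'Z_q}) d :
    #|T| = (q %/ 2)%N -> obtained_from N x T d ->
  [/\ uniq d,
      forall B, B \in d -> exists r a, B = block N x T r a
    & BIBD (N - 1) (size d) (N %/ 2 - 1) d].
Proof.
move=> card_T dT.
have [R [sR d_perm [lambda lambdaP]]] : exists R : {set 'Z_q},
    [/\ R \subset period_range T, perm_eq d (blocks N x T R)
      & exists lambda, forall c, c != 0 ->
        (\sum_(r in R) difference_count (translate T r) c)%N = lambda].
  case: dT => [d_perm | [n_odd [U admU d_perm]]].
    exists (period_range T); split=> //.
    by eexists=> c c_neq0; rewrite sum_difference_count.
  exists U; split=> //; first by case: admU.
  exists (\sum_(r in period_range T) difference_count (translate T r) 1%R)./2%N.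
  move=> c c_neq0; rewrite -(sum_difference_count T c_neq0).
  by rewrite -(sum_admissible c n_odd admU) doubleK.
have memd B : B \in d -> exists r a, B = block N x T r a.
  by rewrite (perm_mem d_perm) => /allpairsP[[r a] /= [_ _ ->]]; exists r, a.
have countd s t : count (fun B : {set F} => (s \in B) && (t \in B)) d =
    (\sum_(r in R) difference_count (translate T r) (s - t)%R)%N.
  by have /seq.permP-> := d_perm; exact: count_blocks.
split=> //; first by rewrite (perm_uniq d_perm) uniq_blocks.
split=> //.
- move=> B /memd[r [a ->]]; rewrite card_block -(doubleK (n * _)%N).
  by rewrite double_card // -divn2 divnBr // divnn.
- exists (\sum_(r in R) difference_count (translate T r) 0%R)%N => s.
  by rewrite -(subrr s) -countd; apply: eq_count => B; rewrite andbb.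
- by exists lambda => s t st; rewrite countd lambdaP // subr_eq0.
Qed.

End Cyclotomy.

(** * Union of the two designs *)

Lemma BIBD_cat (V : finType) v b1 b2 k (D1 D2 : seq {set V}) :
  BIBD v b1 k D1 -> BIBD v b2 k D2 -> BIBD v (b1 + b2) k (D1 ++ D2).
Proof.
move=> [cV <- k1 [r1 r1P] [l1 l1P]] [_ <- k2 [r2 r2P] [l2 l2P]].
split=> //; first by rewrite size_cat.
- by move=> B; rewrite mem_cat => /orP[/k1|/k2].
- by exists (r1 + r2)%N => s; rewrite count_cat r1P r2P.
- by exists (l1 + l2)%N => s t st; rewrite count_cat l1P // l2P.
Qed.

Theorem theorem2p3 (N p m : nat) (F : finFieldType) (x : {unit F}) (q : nat)
    (T T' : {set 'Z_q}) (d1 d2 : seq {set F})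
    (N_gt0 : (0 < N)%N) (N_even : ~~ odd N)
    (p_prime : prime p) (p_odd : odd p) (m_gt0 : (0 < m)%N)
    (N_primepower : (N - 1 = p ^ m)%N)
    (card_F : #|F| = (N - 1)%N)
    (x_primitive : generator [set: {unit F}] x)
    (q_gt0 : (0 < q)%N) (q_even : ~~ odd q)
    (q_dvd : (q %| N - 2)%N) (q_neq : q <> (N - 2)%N)
    (card_T : #|T| = (q %/ 2)%N) (card_T' : #|T'| = (q %/ 2)%N)
    (T'_neq : forall a : 'Z_q, T' <> translate T a)
    (d1_T : obtained_from N x T d1) (d2_T' : obtained_from N x T' d2) :
  (forall B : {set F}, ~ (B \in d1 /\ B \in d2)) /\
  (BIBD (N - 1) (size d1 + size d2) (N %/ 2 - 1) (d1 ++ d2) /\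
   uniq (d1 ++ d2)).
Proof.
have q_gt1 : (1 < q)%N.
  by rewrite ltn_neqAle q_gt0 andbT; apply: contraNneq q_even => <-.
have obtainedP := obtained_fromP card_F x_primitive q_gt1 q_dvd q_even q_neq.
have [uniq1 mem1 bibd1] := obtainedP _ _ card_T d1_T.
have [uniq2 mem2 bibd2] := obtainedP _ _ card_T' d2_T'.
have disjoint_d B : ~ (B \in d1 /\ B \in d2).
  case=> /mem1[r [a ->]] /mem2[s [b]].
  case/(block_inj card_F x_primitive q_gt1 q_dvd q_even q_neq card_T) => Trs _.
  (* Equal blocks mean [T + r = T' + s], that is [T' = T + (r - s)]. *)
  apply: (T'_neq (r - s)).
  by rewrite -translateD Trs translateD subrr translate0.
split=> //; split; first exact: BIBD_cat.
rewrite cat_uniq uniq1 uniq2 andbT; apply/hasPn => B B2.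
by apply/negP => B1; apply: (disjoint_d B).
Qed.
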